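(* Let $\mathbb{T}$ be a time scale, let $f:\mathbb{T}\to\mathbb{R}$ and let $t\in\mathbb{T}_{\kappa}^{\kappa}$. The following hold: (i) The function $f$ has at most one symmetric derivative at $t$. (ii) If $f$ is symmetric differentiable at $t$, then $f$ is symmetric continuous at $t$. (iii) If $f$ is continuous at $t$ and $t$ is not dense, then $f$ is symmetric differentiable at $t$ with $$f^{\diamondsuit}(t)=\frac{f^{\sigma}(t)-f^{\rho}(t)}{\sigma(t)-\rho(t)}.$$ (iv) If $t$ is dense, then $f$ is symmetric differentiable at $t$ if and only if the limit $$\lim_{s\to t}\frac{f(2t-s)-f(s)}{2t-2s}$$ exists as a finite number. In this case $$f^{\diamondsuit}(t)=\lim_{s\to t}\frac{f(2t-s)-f(s)}{2t-2s}=\lim_{h\to 0}\frac{f(t+h)-f(t-h)}{2h}.$$ (v) If $f$ is symmetric differentiable and continuous at $t$, then $$f^{\sigma}(t)=f^{\rho}(t)+f^{\diamondsuit}(t)\,[\sigma(t)-\rho(t)].$$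
   Context: A time scale $\mathbb{T}$ is a nonempty closed subset of $\mathbb{R}$, with the topology inherited from the standard topology of $\mathbb{R}$. The forward jump operator $\sigma:\mathbb{T}\to\mathbb{T}$ is $\sigma(t):=\inf\{s\in\mathbb{T}:s>t\}$ with the convention $\inf\emptyset=\sup\mathbb{T}$ (so $\sigma(M)=M$ if $\mathbb{T}$ has a maximum $M$); the backward jump operator $\rho:\mathbb{T}\to\mathbb{T}$ is $\rho(t):=\sup\{s\in\mathbb{T}:s<t\}$ with $\sup\emptyset=\inf\mathbb{T}$ (so $\rho(m)=m$ if $\mathbb{T}$ has a minimum $m$). A point $t\in\mathbb{T}$ is right-dense if $\sigma(t)=t$, right-scattered if $\sigma(t)>t$, left-dense if $\rho(t)=t$, left-scattered if $\rho(t)<t$; $t$ is dense if it is both right-dense and left-dense. If $\sup\mathbb{T}$ is finite and left-scattered, $\mathbb{T}^{\kappa}:=\mathbb{T}\setminus\{\sup\mathbb{T}\}$, otherwise $\mathbb{T}^{\kappa}:=\mathbb{T}$; if $\inf\mathbb{T}$ is finite and right-scattered, $\mathbb{T}_{\kappa}:=\mathbb{T}\setminus\{\inf\mathbb{T}\}$, otherwise $\mathbb{T}_{\kappa}:=\mathbb{T}$; $\mathbb{T}_{\kappa}^{\kappa}:=\mathbb{T}_{\kappa}\cap\mathbb{T}^{\kappa}$. Write $f^{\sigma}:=f\circ\sigma$ and $f^{\rho}:=f\circ\rho$. Symmetric continuity: $f:\mathbb{T}\to\mathbb{R}$ is symmetric continuous at $t\in\mathbb{T}$ if for every $\varepsilon>0$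 there is a neighborhood $U_t\subset\mathbb{T}$ of $t$ such that $|f(s)-f(2t-s)|\leqslant\varepsilon$ for all $s\in U_t$ for which $2t-s\in U_t$. Symmetric derivative: for $f:\mathbb{T}\to\mathbb{R}$ and $t\in\mathbb{T}_{\kappa}^{\kappa}$, the symmetric derivative of $f$ at $t$, denoted $f^{\diamondsuit}(t)$, is the real number (provided it exists) such that for every $\varepsilon>0$ there is a neighborhood $U\subset\mathbb{T}$ of $t$ with $$\left|\left[f^{\sigma}(t)-f(s)+f(2t-s)-f^{\rho}(t)\right]-f^{\diamondsuit}(t)\left[\sigma(t)+2t-2s-\rho(t)\right]\right|\leqslant\varepsilon\left|\sigma(t)+2t-2s-\rho(t)\right|$$ for all $s\in U$ for which $2t-s\in U$. When such a number exists, $f$ is said to be symmetric differentiable at $t$. In the limits, $s$ ranges over points $s\neq t$ with $s\in\mathbb{T}$ and $2t-s\in\mathbb{T}$, and $h$ ranges over $h\neq 0$ with $t+h\in\mathbb{T}$ and $t-h\in\mathbb{T}$.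
   Formalization: In (i), if t is dense it is also assumed to be a limit point of the points s with s and 2t−s in the time scale; otherwise (e.g. [0,1] at t=0) every real number is a symmetric derivative and (i) fails. *)

(* Defs.v *)
From HB Require Import structures.
From mathcomp Require Import all_boot all_order all_algebra.
From mathcomp Require Import all_classical all_reals all_analysis.

Set Implicit Arguments.
Unset Strict Implicit.
Unset Printing Implicit Defensive.

Import Order.TTheory GRing.Theory Num.Theory numFieldNormedType.Exports.

Local Open Scope classical_set_scope.
Local Open Scope ring_scope.

(* A function on a time scale T is represented by a total f : R -> R; every
   notion below only reads the values of f at points of T. *)
Section TimeScale.
Context {R : realType}.
Implicit Types (T : set R) (f : R -> R) (s t h d : R).

Definition time_scale T := closed T /\ T !=set0.

(* The case distinctions implement inf set0 = sup T and sup set0 = inf T;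
   the library's inf set0 and sup set0 are both 0. *)
Definition fjump T t : R :=
  if pselect ([set s | T s /\ t < s] !=set0)
  then inf [set s | T s /\ t < s] else sup T.

Definition bjump T t : R :=
  if pselect ([set s | T s /\ s < t] !=set0)
  then sup [set s | T s /\ s < t] else inf T.

Definition right_dense T t := fjump T t = t.
Definition right_scattered T t := t < fjump T t.
Definition left_dense T t := bjump T t = t.
Definition left_scattered T t := bjump T t < t.
Definition dense_point T t := right_dense T t /\ left_dense T t.

Definition upper_kappa T : set R :=
  if pselect (has_ubound T /\ left_scattered T (sup T))
  then T `\ sup T else T.

Definition lower_kappa T : set R :=
  if pselect (has_lbound T /\ right_scattered T (inf T))
  then T `\ inf T else T.

Definition kappa T : set R := lower_kappa T `&` upper_kappa T.

(* Neighborhoods of t in the topology that T inherits from R. *)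
Definition nbhs_in T t (U : set R) := U `<=` T /\ within T (nbhs t) U.

Definition continuous_in T f t := f s @[s --> within T (nbhs t)] --> f t.

Definition sym_continuous T f t :=
  forall e : R, 0 < e -> exists2 U, nbhs_in T t U &
    forall s, U s -> U (2 * t - s) -> `|f s - f (2 * t - s)| <= e.

Definition is_sym_derive T f t d :=
  forall e : R, 0 < e -> exists2 U, nbhs_in T t U &
    forall s, U s -> U (2 * t - s) ->
      `| (f (fjump T t) - f s + f (2 * t - s) - f (bjump T t))
         - d * (fjump T t + 2 * t - 2 * s - bjump T t) |
      <= e * `| fjump T t + 2 * t - 2 * s - bjump T t |.

Definition sym_differentiable T f t := exists d, is_sym_derive T f t d.

Definition sym_points T t : set R := [set s | T s /\ T (2 * t - s)].

(* Punctured neighborhood filters of the symmetric limits.  They are improper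
   when t is not a limit point of [sym_points T t]. *)
Definition sym_nbhs T t := within (sym_points T t) t^'.

Definition sym_nbhs0 T t := within [set h | T (t + h) /\ T (t - h)] 0^'.

End TimeScale.

(* Main.v *)
Require Import Defs.
From HB Require Import structures.
From mathcomp Require Import all_boot all_order all_algebra.
From mathcomp Require Import all_classical all_reals all_analysis.
From mathcomp Require Import ring lra.
Import Order.TTheory GRing.Theory Num.Theory numFieldNormedType.Exports.
Local Open Scope classical_set_scope.
Local Open Scope ring_scope.

(** Write [sigma] and [rho] for the jumps [fjump T] and [bjump T].  The argument
    splits on whether [t] is dense.

    If [t] is not dense, one of the gaps [(t, sigma(t))], [(rho(t), t)] is a
    nonempty interval missing [T], so the only [s] near [t] with both [s] and
    [2t - s] in [T] is [t] itself ([sym_points_isolated]).  Every condition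
    imposed for [s] near [t] thus reduces to its instance at [s = t], where the
    definition of the symmetric derivative says exactly
    [f(sigma(t)) - f(rho(t)) = d (sigma(t) - rho(t))]
    ([sym_derive_jump]); as [rho(t) < sigma(t)], this determines [d].

    If [t] is dense, the jumps cancel and the defining inequality, divided by
    [|2t - 2s|], is the epsilon form of the convergence of
    [(f(2t - s) - f(s)) / (2t - 2s)] to [d] along the punctured symmetric
    neighborhoods ([sym_derive_denseP]).  Uniqueness is then uniqueness of
    limits, the filter being proper when [t] is a limit point of the symmetric
    points, and symmetric continuity follows from
    [|f(s) - f(2t - s)| <= (1 + |d|) |2t - 2s|] near [t].

    Both cases use that a condition on the [s] in [U] with [2t - s] in [U], for
    some relative neighborhood [U] of [t], is a condition on all symmetric
    points close to [t] ([sym_nearP]). *)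

Section SymmetricDerivative.
Set Implicit Arguments.
Unset Strict Implicit.
Unset Printing Implicit Defensive.
Context {R : realType}.
Implicit Types (T : set R) (f : R -> R) (t d : R).

Lemma sym_center t : 2 * t - t = t. Proof. by ring. Qed.

Lemma kappa_sub T : kappa T `<=` T.
Proof.
move=> t [_]; rewrite /upper_kappa.
by case: pselect => // _ [].
Qed.

Lemma fjump_ge T t : T t -> t <= fjump T t.
Proof.
move=> Tt; rewrite /fjump; case: pselect => [ne|no].
  by apply: lb_le_inf => // s [_ /ltW].
apply: ub_le_sup => //; exists t => s Ts; rewrite leNgt.
by apply/negP => ts; apply: no; exists s.
Qed.

Lemma bjump_le T t : T t -> bjump T t <= t.
Proof.
move=> Tt; rewrite /bjump; case: pselect => [ne|no].
  by apply: ge_sup => // s [_ /ltW].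
apply: ge_inf => //; exists t => s Ts; rewrite leNgt.
by apply/negP => ts; apply: no; exists s.
Qed.

Lemma fjump_le T t s : T s -> t < s -> fjump T t <= s.
Proof.
move=> Ts ts; rewrite /fjump; case: pselect => [?|[]]; last by exists s.
by apply: ge_inf => //; exists t => u [_ /ltW].
Qed.

Lemma bjump_ge T t s : T s -> s < t -> s <= bjump T t.
Proof.
move=> Ts ts; rewrite /bjump; case: pselect => [?|[]]; last by exists s.
by apply: ub_le_sup => //; exists t => u [_ /ltW].
Qed.

Lemma bjump_lt_fjump T t : T t -> ~ dense_point T t -> bjump T t < fjump T t.
Proof.
move=> Tt nd; have ft := fjump_ge Tt; have bt := bjump_le Tt.
rewrite ltNge; apply/negP => fb; apply: nd; split; apply/eqP.
  by rewrite eq_le ft (le_trans fb bt).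
by rewrite eq_le bt (le_trans ft fb).
Qed.

(** Passage from relative neighborhoods, as they appear in the definitions, to
    the filter of neighborhoods of [t] restricted to the symmetric points. *)
Lemma sym_nearP T t (P : R -> Prop) :
  (exists2 U, nbhs_in T t U & forall s, U s -> U (2 * t - s) -> P s) <->
  \forall s \near t, sym_points T t s -> P s.
Proof.
split=> [[U [_ nU] UP]|nP].
  have {}nU : \forall s \near t, T s -> U s := nU.
  have nU' : \forall s \near t, T (2 * t - s) -> U (2 * t - s).
    have refl : (2 * t - s) @[s --> t] --> t.
      rewrite -[X in _ --> X]sym_center.
      by apply: cvgB; [exact: cvg_cst|exact: cvg_id].
    exact: refl nU.
  by apply: (filterS2 _ _ nU nU') => s Us Us' [/Us ? /Us' ?]; exact: UP.
exists (T `&` [set s | sym_points T t s -> P s]).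
  split; first by move=> s [].
  by apply: filterS nP => s Ps Ts; split.
by move=> s [Ts Ps] [Ts' _]; apply: Ps.
Qed.

(** Near a point that is not dense the only symmetric point is the center: if
    [s <> t], one of [s] and [2t - s] lies on the side of a gap of [T] next to
    [t], hence beyond that gap. *)
Lemma sym_points_isolated T t : T t -> ~ dense_point T t ->
  \forall s \near t, sym_points T t s -> s = t.
Proof.
move=> Tt nd; have r0 : 0 < fjump T t - bjump T t.
  by rewrite subr_gt0; exact: bjump_lt_fjump.
have ft := fjump_ge Tt; have bt := bjump_le Tt.
suff [r r_gt0 rP] : exists2 r : R, 0 < r &
    forall s, sym_points T t s -> `|t - s| < r -> s = t.
  apply/nbhs_ballP; exists r => //= s; rewrite /ball /= => ? ?.
  exact: rP.
have [tf|ft'] := ltP t (fjump T t).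
  exists (fjump T t - t); first by rewrite subr_gt0.
  move=> s [Ts Ts']; rewrite ltr_norml => /andP[h1 h2].
  apply/eqP; rewrite eq_le; apply/andP; split; rewrite leNgt; apply/negP => h.
    by have := fjump_le Ts h; lra.
  have : t < 2 * t - s by lra.
  by move=> /(fjump_le Ts'); lra.
exists (t - bjump T t); first by lra.
move=> s [Ts Ts']; rewrite ltr_norml => /andP[h1 h2].
apply/eqP; rewrite eq_le; apply/andP; split; rewrite leNgt; apply/negP => h.
  have : 2 * t - s < t by lra.
  by move=> /(bjump_ge Ts'); lra.
by have := bjump_ge Ts h; lra.
Qed.

Lemma normr_le_eps_eq0 (x y : R) : (forall e, 0 < e -> `|x| <= e * `|y|) -> x = 0.
Proof.
move=> h; apply/eqP; rewrite -normr_le0; apply/ler_addgt0Pl => e e0.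
rewrite addr0; apply: le_trans (h (e / (1 + `|y|)) _) _.
  by rewrite divr_gt0// ltr_wpDr.
have y0 : 0 < 1 + `|y| by rewrite ltr_wpDr.
by rewrite -mulrA ger_pMr// mulrC ler_pdivrMr// mul1r lerDr.
Qed.

(** The instance [s = t] of the definition of the symmetric derivative. *)
Lemma sym_derive_jump T f t d : T t -> is_sym_derive T f t d ->
  f (fjump T t) - f (bjump T t) = d * (fjump T t - bjump T t).
Proof.
move=> Tt fd; apply/eqP; rewrite -subr_eq0; apply/eqP.
apply: (@normr_le_eps_eq0 _ (fjump T t - bjump T t)) => e e0.
have /sym_nearP /nbhs_singleton := fd e e0.
rewrite /sym_points /= sym_center => /(_ (conj Tt Tt)).
by rewrite subrK addrK.
Qed.

Lemma sym_derive_isolated T f t : T t -> ~ dense_point T t ->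
  is_sym_derive T f t
    ((f (fjump T t) - f (bjump T t)) / (fjump T t - bjump T t)).
Proof.
move=> Tt nd e e0; apply/sym_nearP.
apply: filterS (sym_points_isolated Tt nd) => s st /st ->.
rewrite sym_center subrK addrK divfK ?subrr ?normr0 ?mulr_ge0// ?ltW//.
by rewrite subr_eq0 gt_eqF// bjump_lt_fjump.
Qed.

Lemma sym_derive_dense_nearP T f t d : dense_point T t ->
  is_sym_derive T f t d <->
  forall e, 0 < e -> \forall s \near t, sym_points T t s ->
    `|f (2 * t - s) - f s - d * (2 * t - 2 * s)| <= e * `|2 * t - 2 * s|.
Proof.
move=> [rd ld].
have E s : (f t - f s + f (2 * t - s) - f t = f (2 * t - s) - f s) *
           (t + 2 * t - 2 * s - t = 2 * t - 2 * s) by split; ring.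
split=> fd e /fd; rewrite /= rd ld.
  by move=> /sym_nearP; apply: filterS => s; rewrite !E.
by move=> h; apply/sym_nearP; apply: filterS h => s; rewrite !E.
Qed.

(** At a dense point the inequality at [s = t] is trivial, so that dividing by
    [|2t - 2s|] loses nothing. *)
Lemma sym_derive_denseP T f t d : dense_point T t ->
  is_sym_derive T f t d <->
  (f (2 * t - s) - f s) / (2 * t - 2 * s) @[s --> sym_nbhs T t] --> d.
Proof.
move=> dt; apply: (iff_trans (sym_derive_dense_nearP f d dt)).
have E s : s != t ->
    `|f (2 * t - s) - f s - d * (2 * t - 2 * s)| =
    `|d - (f (2 * t - s) - f s) / (2 * t - 2 * s)| * `|2 * t - 2 * s|.
  move=> st; rewrite -normrM distrC; congr `|_|.
  by field; rewrite -mulrBr mulf_neq0// subr_eq0 eq_sym.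
have P s : s != t -> 0 < `|2 * t - 2 * s|.
  by move=> st; rewrite normr_gt0 -mulrBr mulf_neq0// subr_eq0 eq_sym.
split=> [fd|/cvgrPdist_le fd e /fd h].
  apply/cvgrPdist_le => e /fd; apply: filterS => s h st /h.
  by rewrite E// ler_pM2r// P.
have {}h : \forall s \near t, s != t -> sym_points T t s ->
  `|d - (f (2 * t - s) - f s) / (2 * t - 2 * s)| <= e := h.
apply: filterS h => s h Ts; have [->|st] := eqVneq s t.
  by rewrite sym_center !subrr mulr0 subr0 normr0 mulr0.
by rewrite E// ler_pM2r ?P//; apply: h.
Qed.

Lemma sym_nbhs_proper T t :
  limit_point (sym_points T t) t -> ProperFilter (sym_nbhs T t).
Proof.
move=> lt; split; last exact: within_filter.
move=> h.
by have [s [st Ss hs]] := lt _ h; apply: hs.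
Qed.

Lemma sym_derive_unique T f t d1 d2 : T t ->
  (dense_point T t -> limit_point (sym_points T t) t) ->
  is_sym_derive T f t d1 -> is_sym_derive T f t d2 -> d1 = d2.
Proof.
move=> Tt lt fd1 fd2; have [dt|nd] := pselect (dense_point T t).
  have pF := sym_nbhs_proper (lt dt).
  move: fd1 fd2 => /(sym_derive_denseP f d1 dt) + /(sym_derive_denseP f d2 dt).
  exact: cvg_unique.
apply: (@mulIf _ (fjump T t - bjump T t)).
  by rewrite subr_eq0 gt_eqF// bjump_lt_fjump.
by rewrite -(sym_derive_jump Tt fd1) -(sym_derive_jump Tt fd2).
Qed.

Lemma sym_derive_continuous T f t d : T t ->
  is_sym_derive T f t d -> sym_continuous T f t.
Proof.
move=> Tt fd e e0; apply/sym_nearP.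
have [dt|nd] := pselect (dense_point T t); last first.
  apply: filterS (sym_points_isolated Tt nd) => s st /st ->.
  by rewrite sym_center subrr normr0 ltW.
have := (sym_derive_dense_nearP f d dt).1 fd 1 ltr01.
have d0 : 0 < (1 + `|d|) * 2 by rewrite mulr_gt0// ltr_wpDr.
have nt : \forall s \near t, `|t - s| < e / ((1 + `|d|) * 2).
  by apply: (nbhsx_ballx t (e / ((1 + `|d|) * 2))); rewrite divr_gt0.
apply: filterS2 nt => s st h /h {}h.
(* [|f s - f (2t - s)| <= (1 + |d|) 2 |t - s|], which is at most [e] by [st]. *)
have -> : `|f s - f (2 * t - s)| =
    `|(f (2 * t - s) - f s - d * (2 * t - 2 * s)) + d * (2 * t - 2 * s)|.
  by rewrite distrC subrK.
apply: (le_trans (ler_normD _ _)).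
apply: (le_trans (lerD h (lexx _))).
rewrite normrM -mulrDl -mulrBr normrM normr_nat mulrA mulrC.
by rewrite -ler_pdivlMr// ltW.
Qed.

(** The substitution [s = t - h]. *)
Lemma cvg_sym_nbhs0 T t : (t - h) @[h --> sym_nbhs0 T t] --> sym_nbhs T t.
Proof.
move=> A nA.
have refl : (t - h) @[h --> (0 : R)] --> t.
  rewrite -[X in _ --> X]subr0.
  by apply: cvgB; [exact: cvg_cst|exact: cvg_id].
have nA' : \forall h \near (0 : R),
  t - h != t -> sym_points T t (t - h) -> A (t - h) := refl _ nA.
suff : \forall h \near (0 : R), h != 0 -> T (t + h) /\ T (t - h) -> A (t - h).
  by [].
apply: filterS nA' => h Ah h0 [Tp Tm].
apply: Ah; last by split=> //; have -> : 2 * t - (t - h) = t + h by ring.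
by rewrite -subr_eq0 addrAC subrr sub0r oppr_eq0.
Qed.

Lemma sym_derive_dense_cvg0 T f t d : dense_point T t ->
  is_sym_derive T f t d ->
  (f (t + h) - f (t - h)) / (2 * h) @[h --> sym_nbhs0 T t] --> d.
Proof.
move=> dt /(sym_derive_denseP f d dt) /(cvg_comp _ _ (@cvg_sym_nbhs0 T t)).
rewrite (_ : _ \o _ = fun h => (f (t + h) - f (t - h)) / (2 * h))//.
apply/funext => h /=.
by congr ((f _ - _) / _); ring.
Qed.

End SymmetricDerivative.

Theorem theorem3p5 (R : realType) (T : set R) (f : R -> R) (t : R)
    (hT : time_scale T) (ht : kappa T t) :
  (* (i); at a dense t that is not a limit point of sym_points T t, every real
     number is a symmetric derivative of every f *)
  ((dense_point T t -> limit_point (sym_points T t) t) ->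
     forall d1 d2 : R,
       is_sym_derive T f t d1 -> is_sym_derive T f t d2 -> d1 = d2) /\
  (* (ii) *)
  (sym_differentiable T f t -> sym_continuous T f t) /\
  (* (iii) *)
  (continuous_in T f t -> ~ dense_point T t ->
     is_sym_derive T f t
       ((f (fjump T t) - f (bjump T t)) / (fjump T t - bjump T t))) /\
  (* (iv) *)
  (dense_point T t ->
     (sym_differentiable T f t <->
        exists l : R,
          (f (2 * t - s) - f s) / (2 * t - 2 * s) @[s --> sym_nbhs T t] --> l) /\
     (forall d : R, is_sym_derive T f t d ->
        (f (2 * t - s) - f s) / (2 * t - 2 * s) @[s --> sym_nbhs T t] --> d /\
        (f (t + h) - f (t - h)) / (2 * h) @[h --> sym_nbhs0 T t] --> d)) /\
  (* (v) *)
  (continuous_in T f t ->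
     forall d : R, is_sym_derive T f t d ->
       f (fjump T t) = f (bjump T t) + d * (fjump T t - bjump T t)).
Proof.
have Tt := kappa_sub ht.
split; first by move=> lt d1 d2; exact: sym_derive_unique.
split; first by move=> [d]; exact: sym_derive_continuous.
split; first by move=> _; exact: sym_derive_isolated.
split.
  move=> dt; split.
    by split=> -[d /(sym_derive_denseP f d dt) fd]; exists d.
  move=> d fd; split; first exact/(sym_derive_denseP f d dt).
  exact: sym_derive_dense_cvg0.
by move=> _ d /(sym_derive_jump Tt) <-; rewrite addrC subrK.
Qed.
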